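(* Let $m\ge 2$, $n\geq1$, and let $g:S_m^n\to\mathbb R^{(m-1)\times(m-1)}$ satisfy: (i) $\mathbb E_x g(x)=0$; (ii) there is a matrix $M$ with $\mathrm{tr}(M)=1$ and $g(x)g(x)^t=M$ for all $x\in S_m^n$; (iii) $\min_{\ell\in \mathrm{Lin}(S_m^n)}\mathbb E_x\|g(x)-\ell(x)\|_F^2\leq\tau$. Then there exist $i\in[n]$ and a matrix $A\in\mathbb R^{(m-1)\times(m-1)}$ such that $\mathbb E_x\|g(x)-A\rho^1(x_i)\|_F^2\leq O(m^5\tau)$.
   Context: $S_m$ is the symmetric group on $[m]$; expectations are over $x=(x_1,\dots,x_n)$ uniform in $S_m^n$; $\|\cdot\|_F$ is the Frobenius norm. $\rho^1:S_m\to O(m-1)$ is the standard irreducible $(m-1)$-dimensional representation realized by real orthogonal matrices: if $P(z)_{ab}=\mathbf 1_{z(a)=b}$ is the permutation matrix and $U$ is an orthogonal $m\times m$ matrix whose first column is $\frac1{\sqrt m}(1,\dots,1)^t$, then $U^tP(z)U=1\oplus\rho^1(z)$ (block diagonal). $\mathrm{Lin}(S_m^n)$ is the space of functions of the form $x\mapsto\sum_{i=1}^nA^i\rho^1(x_i)$ with $A^i\in\mathbb R^{(m-1)\times(m-1)}$. *)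

(* Defs.v *)
From HB Require Import structures.
From mathcomp Require Import all_boot all_order all_algebra all_fingroup.
From mathcomp Require Import all_classical all_reals.

Set Implicit Arguments.
Unset Strict Implicit.
Unset Printing Implicit Defensive.

Import Order.TTheory GRing.Theory Num.Theory.
Local Open Scope classical_set_scope.
Local Open Scope ring_scope.

Definition expect (R : realType) (T : finType) (V : lmodType R) (f : T -> V)
  : V := #|T|%:R^-1 *: \sum_x f x.

Definition frobenius_norm (R : realType) (p q : nat) (A : 'M[R]_(p, q)) : R :=
  Num.sqrt (\sum_i \sum_j A i j ^+ 2).

Definition mean_sq_dist (R : realType) (T : finType) (p q : nat)
    (f h : T -> 'M[R]_(p, q)) : R :=
  expect (fun x => frobenius_norm (f x - h x) ^+ 2 : R^o).

(* [i0 : 'I_m] is meant to be the first index. *)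
Definition is_std_basis (R : realType) (m : nat) (i0 : 'I_m) (U : 'M[R]_m)
  : Prop :=
  U^T *m U = 1%:M /\ col i0 U = const_mx (Num.sqrt m%:R)^-1.

(* [perm_mx z a b = (z a == b)%:R]. Under [is_std_basis i0 U] the matrix
   [U^T *m perm_mx z *m U] has a 1 at [(i0, i0)] and zeros elsewhere in row and
   column [i0] (lemmas [std_conj_row] and [std_conj_col] below); [rho1] is the
   complementary diagonal block. *)
Definition rho1 (R : realType) (m : nat) (i0 : 'I_m) (U : 'M[R]_m) (z : 'S_m)
  : 'M[R]_m.-1 :=
  row' i0 (col' i0 (U^T *m perm_mx z *m U)).

Lemma std_conj_col (R : realType) (m : nat) (i0 : 'I_m) (U : 'M[R]_m)
    (z : 'S_m) : is_std_basis i0 U ->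
  col i0 (U^T *m perm_mx z *m U) = delta_mx i0 0.
Proof.
move=> [UU U0]; rewrite colE -!mulmxA -colE.
have -> : perm_mx z *m col i0 U = col i0 U.
  rewrite U0; apply/matrixP => a b.
  by rewrite -row_permE !mxE.
by rewrite colE mulmxA UU mul1mx.
Qed.

Lemma std_conj_row (R : realType) (m : nat) (i0 : 'I_m) (U : 'M[R]_m)
    (z : 'S_m) : is_std_basis i0 U ->
  row i0 (U^T *m perm_mx z *m U) = delta_mx 0 i0.
Proof.
move=> bU; apply: trmx_inj.
rewrite tr_row !trmx_mul trmxK tr_perm_mx trmx_delta mulmxA.
exact: std_conj_col.
Qed.

Definition Lin (R : realType) (m n : nat) (i0 : 'I_m) (U : 'M[R]_m)
  : set ({ffun 'I_n -> 'S_m} -> 'M[R]_m.-1) :=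
  [set l : {ffun 'I_n -> 'S_m} -> 'M[R]_m.-1 |
    exists A : 'I_n -> 'M[R]_m.-1,
      forall x, l x = \sum_i A i *m rho1 i0 U (x i)].

Definition is_min (R : realType) (S : set R) (mu : R) : Prop :=
  S mu /\ lbound S mu.

(* Main.v *)
(* Let [f = \sum_i A i rho(x_i)] be a linear function with
   [E |g - f|^2 <= tau]. For a set [I] of coordinates write [f = F + G], where
   [F] collects the terms of [I]. Multiplying all [x_i], [i \in I], on the right by
   one uniform [z] turns [f] into [F rho(z) + G] and [f f^t] into
   [F F^t + G G^t + F rho(z) G^t + (F rho(z) G^t)^t]. As [f f^t] is close to the
   constant [M], the part depending on [z] is small; by Schur orthogonality its
   mean square is at least [2 |F|^2 |G|^2 / (m - 1)], so [|F|^2 |G|^2] is small.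
   Moreover [|F|^2 + |G|^2], the mean of [|f|^2] over [z], is nearly [1];
   since [F] and [G] are independent, each of [|F|^2], [|G|^2] is then nearly
   constant. Hence no [I] splits the weight [E |f|^2] into two substantial
   halves, so a single coordinate [i] carries most of it. For [I = [set i]] the
   norm of [F] is constant, and the bound on [|F|^2 |G|^2] gives
   [E |G|^2 = O(m tau)]. *)
Require Import Defs.
From HB Require Import structures.
From mathcomp Require Import all_boot all_order all_algebra all_fingroup.
From mathcomp Require Import all_classical all_reals.
From mathcomp Require Import ring lra.

Set Implicit Arguments.
Unset Strict Implicit.
Unset Printing Implicit Defensive.

Import Order.TTheory GRing.Theory Num.Theory.
Local Open Scope ring_scope.

(** * Averages of real functions over a finite type *)

Section Mean.
Variable R : realType.

Definition mean (T : finType) (f : T -> R) : R := #|T|%:R^-1 * \sum_x f x.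

Lemma eq_mean (T : finType) (f h : T -> R) : f =1 h -> mean f = mean h.
Proof. by move=> fh; congr (_ * _); apply: eq_bigr => x _; apply: fh. Qed.

Lemma meanD (T : finType) (f h : T -> R) :
  mean (fun x => f x + h x) = mean f + mean h.
Proof. by rewrite /mean big_split mulrDr. Qed.

Lemma meanZ (T : finType) (c : R) (f : T -> R) :
  mean (fun x => c * f x) = c * mean f.
Proof. by rewrite /mean -mulr_sumr mulrCA. Qed.

Lemma meanB (T : finType) (f h : T -> R) :
  mean (fun x => f x - h x) = mean f - mean h.
Proof. by rewrite /mean sumrB mulrBr. Qed.

Lemma mean_sum (T I : finType) (P : pred I) (F : I -> T -> R) :
  mean (fun x => \sum_(i | P i) F i x) = \sum_(i | P i) mean (F i).
Proof. by rewrite /mean exchange_big mulr_sumr. Qed.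

Lemma mean_cst (T : finType) (t0 : T) (c : R) : mean (fun _ : T => c) = c.
Proof.
rewrite /mean sumr_const -[c *+ _]mulr_natl mulrA mulVf ?mul1r //.
by rewrite pnatr_eq0 -lt0n; apply/card_gt0P; exists t0.
Qed.

Lemma le_mean (T : finType) (f h : T -> R) :
  (forall x, f x <= h x) -> mean f <= mean h.
Proof.
by move=> fh; apply: ler_wpM2l; [rewrite invr_ge0 ler0n | apply: ler_sum].
Qed.

Lemma ler_norm_mean (T : finType) (f : T -> R) :
  `|mean f| <= mean (fun x => `|f x|).
Proof.
rewrite normrM ger0_norm ?invr_ge0 ?ler0n //.
by apply: ler_wpM2l; [rewrite invr_ge0 ler0n | apply: ler_norm_sum].
Qed.

Lemma mean_inj (T : finType) (s : T -> T) (f : T -> R) :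
  injective s -> mean (fun x => f (s x)) = mean f.
Proof. by move=> s_inj; rewrite /mean [in RHS](reindex_inj s_inj). Qed.

Lemma mean_swap (T T' : finType) (f : T -> T' -> R) :
  mean (fun x => mean (f x)) = mean (fun y => mean (f^~ y)).
Proof. by rewrite /mean -!mulr_sumr exchange_big mulrCA. Qed.

End Mean.

(** * The Frobenius inner product and its squared norm *)

Section SquareNorm.
Variable R : realType.

Definition dotmx (p q : nat) (A B : 'M[R]_(p, q)) : R := \tr (A *m B^T).
Definition sqnorm (p q : nat) (A : 'M[R]_(p, q)) : R := dotmx A A.

Lemma sqnormE (p q : nat) (A : 'M[R]_(p, q)) :
  sqnorm A = \sum_i \sum_j A i j ^+ 2.
Proof.
apply: eq_bigr => i _; rewrite mxE.
by apply: eq_bigr => j _; rewrite mxE expr2.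
Qed.

Lemma dotmxC (p q : nat) (A B : 'M[R]_(p, q)) : dotmx A B = dotmx B A.
Proof. by rewrite /dotmx -mxtrace_tr trmx_mul trmxK. Qed.

Lemma dotmxDl (p q : nat) (A B C : 'M[R]_(p, q)) :
  dotmx (A + B) C = dotmx A C + dotmx B C.
Proof. by rewrite /dotmx mulmxDl mxtraceD. Qed.

Lemma dotmxZl (p q : nat) (c : R) (A B : 'M[R]_(p, q)) :
  dotmx (c *: A) B = c * dotmx A B.
Proof. by rewrite /dotmx -scalemxAl mxtraceZ. Qed.

Lemma sqnormD (p q : nat) (A B : 'M[R]_(p, q)) :
  sqnorm (A + B) = sqnorm A + sqnorm B + 2 * dotmx A B.
Proof.
rewrite /sqnorm dotmxDl (dotmxC A) (dotmxC B) !dotmxDl (dotmxC B A).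
by ring.
Qed.

Lemma sqnormZ (p q : nat) (c : R) (A : 'M[R]_(p, q)) :
  sqnorm (c *: A) = c ^+ 2 * sqnorm A.
Proof. by rewrite /sqnorm dotmxZl dotmxC dotmxZl mulrA. Qed.

Lemma sqnormN (p q : nat) (A : 'M[R]_(p, q)) : sqnorm (- A) = sqnorm A.
Proof. by rewrite -scaleN1r sqnormZ sqrrN expr1n mul1r. Qed.

Lemma sqnorm_ge0 (p q : nat) (A : 'M[R]_(p, q)) : 0 <= sqnorm A.
Proof.
by rewrite sqnormE; do 2 ![apply: sumr_ge0 => ? _]; exact: sqr_ge0.
Qed.

Lemma sqnorm_tr (p q : nat) (A : 'M[R]_(p, q)) : sqnorm A^T = sqnorm A.
Proof. by rewrite /sqnorm /dotmx trmxK mxtrace_mulC. Qed.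

Lemma sqnormD_le (p q : nat) (A B : 'M[R]_(p, q)) :
  sqnorm (A + B) <= 2 * sqnorm A + 2 * sqnorm B.
Proof.
have := sqnorm_ge0 (A - B); rewrite -scaleN1r !sqnormD sqnormZ.
by rewrite (dotmxC A (_ *: _)) dotmxZl (dotmxC B); lra.
Qed.

(** Cauchy-Schwarz by Lagrange's identity: the double sum of [(a i * b j - a j * b i) ^+ 2] is twice
    the difference of the two sides. *)
Lemma sqr_sum_mul_le (I : finType) (a b : I -> R) :
  (\sum_i a i * b i) ^+ 2 <= (\sum_i a i ^+ 2) * (\sum_i b i ^+ 2).
Proof.
have : 0 <= \sum_i \sum_j (a i * b j - a j * b i) ^+ 2.
  by do 2 ![apply: sumr_ge0 => ? _]; exact: sqr_ge0.
under eq_bigr => i _.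
  under eq_bigr => j _.
    rewrite (_ : _ ^+ 2 = a i ^+ 2 * b j ^+ 2 + b i ^+ 2 * a j ^+ 2
      + (- 2) * (a i * b i) * (a j * b j)); last by ring.
    over.
  rewrite !big_split /= -!mulr_sumr; over.
rewrite !big_split /= -!mulr_suml -mulr_sumr expr2 => h.
rewrite -subr_ge0; move: h; lra.
Qed.

Lemma sqnorm_mul_le (p q r : nat) (A : 'M[R]_(p, q)) (B : 'M[R]_(q, r)) :
  sqnorm (A *m B) <= sqnorm A * sqnorm B.
Proof.
rewrite -(sqnorm_tr B) !sqnormE mulr_suml; apply: ler_sum => i _.
rewrite mulr_sumr; apply: ler_sum => j _.
rewrite mxE; apply: le_trans (sqr_sum_mul_le _ _) _.
by under [X in _ <= _ * X]eq_bigr => k _ do rewrite mxE.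
Qed.

End SquareNorm.
Lemma dotmxE (R : realType) (p q : nat) (A B : 'M[R]_(p, q)) :
  dotmx A B = \sum_i \sum_j A i j * B i j.
Proof.
apply: eq_bigr => i _; rewrite mxE.
by apply: eq_bigr => j _; rewrite mxE.
Qed.

(** * Representations satisfying Schur orthogonality *)

(** The last clause is Schur orthogonality of the matrix entries. Stated for any finite group, so
    that permutations enter only when [rho1] is shown to satisfy it. *)
Definition is_orthogonal_design (R : realType) (T : finGroupType) (d : nat)
    (rho : T -> 'M[R]_d) : Prop :=
  [/\ {morph rho : x y / (x * y)%g >-> x *m y},
      forall z, rho z *m (rho z)^T = 1%:M,
      forall a b, mean (fun z => rho z a b) = 0
    & forall a b c e, mean (fun z => rho z a b * rho z c e)
        = ((a == c) && (b == e))%:R / d%:R].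

Section Design.
Variables (R : realType) (T : finGroupType) (d : nat) (rho : T -> 'M[R]_d).
Hypothesis rho_design : is_orthogonal_design rho.

Lemma mean_dotmx_design (B : 'M[R]_d) : mean (fun z => dotmx B (rho z)) = 0.
Proof.
have [_ _ h _] := rho_design.
under eq_mean => z do rewrite dotmxE.
rewrite mean_sum big1 // => i _; rewrite mean_sum big1 // => j _.
by rewrite meanZ h mulr0.
Qed.

Lemma sandwichE (p q : nat) (F : 'M[R]_(p, d)) (r : 'M[R]_d)
    (G : 'M[R]_(q, d)) i j :
  (F *m r *m G^T) i j = \sum_a \sum_b F i a * G j b * r a b.
Proof.
rewrite mxE exchange_big; apply: eq_bigr => b _.
rewrite !mxE mulr_suml; apply: eq_bigr => a _.
by rewrite mulrAC.
Qed.

Lemma mean_sandwich (p q : nat) (F : 'M[R]_(p, d)) (G : 'M[R]_(q, d)) i j :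
  mean (fun z => (F *m rho z *m G^T) i j) = 0.
Proof.
have [_ _ h _] := rho_design.
under eq_mean => z do rewrite sandwichE.
rewrite mean_sum big1 // => a _; rewrite mean_sum big1 // => b _.
by rewrite meanZ h mulr0.
Qed.

(** In the fourfold sum over inner indices, Schur orthogonality keeps only the terms with [a = c]
    and [b = e]. *)
Lemma mean_sandwichM (p q : nat) (F : 'M[R]_(p, d)) (G : 'M[R]_(q, d))
    i j k l :
  mean (fun z => (F *m rho z *m G^T) i j * (F *m rho z *m G^T) k l)
  = (F *m F^T) i k * (G *m G^T) j l / d%:R.
Proof.
have [_ _ _ h] := rho_design.
under eq_mean => z.
  rewrite !sandwichE mulr_suml.
  under eq_bigr => a _.
    rewrite mulr_suml.
    under eq_bigr => b _.
      rewrite mulr_sumr.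
      under eq_bigr => c _.
        rewrite mulr_sumr.
        under eq_bigr => e _ do rewrite mulrACA.
        over.
      over.
    over.
  over.
rewrite mean_sum mxE !mulr_suml; apply: eq_bigr => a _.
rewrite mean_sum [(G *m _) _ _]mxE mulr_sumr mulr_suml; apply: eq_bigr => b _.
rewrite mean_sum (bigD1 a) //= [X in _ + X]big1 ?addr0; last first.
  move=> c; rewrite eq_sym => /negPf ca.
  by rewrite mean_sum big1 // => e _; rewrite meanZ h ca mul0r mulr0.
rewrite mean_sum (bigD1 b) //= [X in _ + X]big1 ?addr0; last first.
  move=> e; rewrite eq_sym => /negPf eb.
  by rewrite meanZ h eb andbF mul0r mulr0.
by rewrite meanZ h !eqxx /= div1r !mxE; ring.
Qed.

(* The cross term of the square is [\tr (F F^T G G^T) = |F^T G|^2], hence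
   nonnegative. *)
Lemma mean_sqnorm_sym_sandwich (F G : 'M[R]_d) :
  2 / d%:R * (sqnorm F * sqnorm G) <=
  mean (fun z => sqnorm (F *m rho z *m G^T + (F *m rho z *m G^T)^T)).
Proof.
set X := fun z => F *m rho z *m G^T.
have -> : mean (fun z => sqnorm (X z + (X z)^T)) =
    2 * (\sum_i \sum_j mean (fun z => X z i j * X z i j)) +
    2 * (\sum_i \sum_j mean (fun z => X z i j * X z j i)).
  under eq_mean => z.
    rewrite sqnormD sqnorm_tr -mulr2n -[sqnorm _ *+ 2]mulr_natl /sqnorm !dotmxE.
    over.
  rewrite meanD !meanZ !mean_sum; congr (_ * _ + _ * _);
    apply: eq_bigr => i _; rewrite mean_sum //; apply: eq_bigr => j _.
  by apply: eq_mean => z; rewrite [_^T _ _]mxE.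
under eq_bigr => i _ do under eq_bigr => j _ do rewrite mean_sandwichM.
under [X in _ + 2 * X]eq_bigr => i _ do
  under eq_bigr => j _ do rewrite mean_sandwichM.
have -> : \sum_i \sum_j (F *m F^T) i i * (G *m G^T) j j / d%:R =
    sqnorm F * sqnorm G / d%:R.
  rewrite mulr_suml mulr_suml; apply: eq_bigr => i _.
  by rewrite mulr_sumr mulr_suml.
have -> : \sum_i \sum_j (F *m F^T) i j * (G *m G^T) j i / d%:R =
    sqnorm (F^T *m G) / d%:R.
  rewrite /sqnorm /dotmx trmx_mul trmxK mxtrace_mulC !mulmxA mxtrace_mulC.
  rewrite !mulmxA -mulmxA mxtrace_mulC mulr_suml; apply: eq_bigr => i _.
  by rewrite mxE mulr_suml.
rewrite -[leLHS]mulrA [d%:R^-1 * _]mulrC lerDl !mulr_ge0 ?invr_ge0 ?ler0n //.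
exact: sqnorm_ge0.
Qed.

Lemma sqnorm_mul_design (p : nat) (F : 'M[R]_(p, d)) z :
  sqnorm (F *m rho z) = sqnorm F.
Proof.
have [_ h _ _] := rho_design.
by rewrite /sqnorm /dotmx trmx_mul mulmxA -(mulmxA F) h mulmx1.
Qed.

(** The cross term is linear in [rho z], hence averages to zero, and [rho z] is orthogonal. *)
Lemma mean_sqnorm_affine (F G : 'M[R]_d) :
  mean (fun z => sqnorm (F *m rho z + G)) = sqnorm F + sqnorm G.
Proof.
under eq_mean => z.
  rewrite sqnormD sqnorm_mul_design (_ : dotmx _ G = dotmx (F^T *m G) (rho z)).
    over.
  by rewrite dotmxC /dotmx trmx_mul mulmxA mxtrace_mulC mulmxA.
by rewrite meanD meanZ mean_dotmx_design mulr0 addr0 (mean_cst 1%g).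
Qed.

(** The sandwich has mean zero in [z], so a constant [K] adds exactly [sqnorm K] to the mean. This
    serves to discard the part of [f f^t - M] that does not depend on [z]. *)
Lemma mean_sqnorm_sym_sandwich_le (F G K : 'M[R]_d) :
  mean (fun z => sqnorm (F *m rho z *m G^T + (F *m rho z *m G^T)^T)) <=
  mean (fun z => sqnorm (F *m rho z *m G^T + (F *m rho z *m G^T)^T + K)).
Proof.
set X := fun z => F *m rho z *m G^T.
have X0 B : mean (fun z => dotmx (X z) B) = 0.
  under eq_mean => z do rewrite dotmxE.
  rewrite mean_sum big1 // => i _; rewrite mean_sum big1 // => j _.
  under eq_mean => z do rewrite mulrC.
  by rewrite meanZ mean_sandwich mulr0.
under [leRHS]eq_mean => z.
  rewrite sqnormD dotmxDl (_ : dotmx (X z)^T K = dotmx (X z) K^T); first over.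
  by rewrite /dotmx trmxK -mxtrace_tr trmx_mul !trmxK mxtrace_mulC.
rewrite meanD meanD meanZ meanD !X0 (mean_cst 1%g) addr0 mulr0 addr0.
by rewrite lerDl sqnorm_ge0.
Qed.

End Design.

(** * Functions with constant Gram matrix that are close to linear *)

Section NearLinear.
Variables (R : realType) (T : finGroupType) (d : nat) (rho : T -> 'M[R]_d).
Hypothesis rho_design : is_orthogonal_design rho.
Variables (J : finType) (A : J -> 'M[R]_d).

Definition part (I : {set J}) (x : {ffun J -> T}) : 'M[R]_d :=
  \sum_(i in I) A i *m rho (x i).

(** A constant [w] multiplies the coordinates in [I] by one common element; a uniform [w] resamples
    them independently. Both uses occur below. *)
Definition rot (I : {set J}) (w x : {ffun J -> T}) : {ffun J -> T} :=
  [ffun i => if i \in I then (x i * w i)%g else x i].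

Lemma rot_inj I w : injective (rot I w).
Proof.
move=> x y /ffunP xy; apply/ffunP => i; have := xy i; rewrite !ffunE.
by case: ifP => // _ /mulIg.
Qed.

Lemma part_setU (I K : {set J}) x :
  [disjoint I & K] -> part (I :|: K) x = part I x + part K x.
Proof.
move=> dIK; rewrite /part -bigU //; apply: eq_bigl => i.
by rewrite !inE.
Qed.

Lemma disjoint_setC (I : {set J}) : [disjoint I & ~: I].
Proof. by rewrite -finset.setI_eq0 finset.setICr. Qed.

Lemma part_setC I x : part [set: J] x = part I x + part (~: I) x.
Proof. by rewrite -part_setU ?disjoint_setC // finset.setUCr. Qed.

Lemma part_rot_in I z x :
  part I (rot I [ffun=> z] x) = part I x *m rho z.
Proof.
have [h _ _ _] := rho_design.
rewrite /part mulmx_suml; apply: eq_bigr => i iI.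
by rewrite !ffunE iI h mulmxA.
Qed.

Lemma part_rot_out (I K : {set J}) w x :
  [disjoint I & K] -> part K (rot I w x) = part K x.
Proof.
move=> dIK; apply: eq_bigr => i iK; rewrite ffunE.
by rewrite (disjointFl dIK iK).
Qed.

Lemma mean_ffun_cst (c : R) : mean (fun _ : {ffun J -> T} => c) = c.
Proof. exact: (mean_cst [ffun=> 1%g]). Qed.

Definition weight (I : {set J}) : R := mean (fun x => sqnorm (part I x)).

Lemma mean_rot (I : {set J}) (phi : {ffun J -> T} -> R) :
  mean (fun x => mean (fun z => phi (rot I [ffun=> z] x))) = mean phi.
Proof.
rewrite mean_swap -[RHS](mean_cst (1%g : T)); apply: eq_mean => z.
exact/mean_inj/rot_inj.
Qed.

(** Rotating the coordinates in [I] by a common [z] makes the cross term average to zero. *)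
Lemma weight_setU (I K : {set J}) :
  [disjoint I & K] -> weight (I :|: K) = weight I + weight K.
Proof.
move=> dIK; rewrite /weight -(mean_rot I) -meanD; apply: eq_mean => x.
under eq_mean => z do
  rewrite part_setU // part_rot_in part_rot_out //.
exact: mean_sqnorm_affine.
Qed.

Lemma weight0 : weight finset.set0 = 0.
Proof.
have -> : weight finset.set0 = mean (fun _ : {ffun J -> T} => 0).
  apply: eq_mean => x.
  by rewrite /part finset.big_set0 /sqnorm /dotmx mul0mx mxtrace0.
by rewrite /mean big1 ?mulr0.
Qed.

Lemma sqnorm_part1 i x : sqnorm (part [set i] x) = sqnorm (A i).
Proof. by rewrite /part finset.big_set1 sqnorm_mul_design. Qed.

Lemma weight1 i : weight [set i] = sqnorm (A i).
Proof.
rewrite /weight; under eq_mean => x do rewrite sqnorm_part1.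
by rewrite mean_ffun_cst.
Qed.

(** By [mean_sqnorm_affine] this is the mean over [z] of [sqnorm (part [set: J] (rot I [ffun=> z]
    x))]. *)
Definition split_sqnorm I x := sqnorm (part I x) + sqnorm (part (~: I) x).

Variables (g : {ffun J -> T} -> 'M[R]_d) (M : 'M[R]_d) (tau : R).
Hypotheses (trM : \tr M = 1) (gM : forall x, g x *m (g x)^T = M).

Definition defect x : R := sqnorm (g x - part [set: J] x).
(** Averaging over rotations only keeps the estimates below pointwise in [x]; [mean_rot] then
    restores the mean of [defect]. *)
Definition avg_defect I x : R := mean (fun z => defect (rot I [ffun=> z] x)).

Hypothesis defect_le : mean defect <= tau.

Lemma sqnorm_g x : sqnorm (g x) = 1.
Proof. by rewrite /sqnorm /dotmx gM. Qed.

Lemma mean_avg_defect I : mean (avg_defect I) <= tau.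
Proof. by rewrite mean_rot. Qed.

Lemma avg_defect_ge0 I x : 0 <= avg_defect I x.
Proof.
rewrite -(mean_cst (1%g : T) 0); apply: le_mean => z; exact: sqnorm_ge0.
Qed.

(* Optimizing over [t] gives [(s - 1) ^+ 2] with [s] the square root of
   [split_sqnorm I x]. *)
Lemma avg_defect_ge t I x : 0 < t ->
  (1 - t^-1) * split_sqnorm I x + (1 - t) <= avg_defect I x.
Proof.
move=> t0; rewrite /split_sqnorm -(mean_sqnorm_affine rho_design).
rewrite -meanZ -[X in _ + X](mean_cst (1%g : T)) -meanD; apply: le_mean => z.
rewrite -part_rot_in -(part_rot_out [ffun=> z] x (disjoint_setC I)).
rewrite -part_setC; set y := rot _ _ _; set f := part _ y.
rewrite /defect -/f -scaleN1r !sqnormD sqnorm_g sqnormZ (dotmxC (g y)) dotmxZl.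
(* Expanding this square bounds [2 * dotmx f (g y)] by [t^-1 * sqnorm f + t]. *)
have : 0 <= t^-1 * sqnorm (f + (- t) *: g y).
  by rewrite mulr_ge0 ?sqnorm_ge0 // invr_ge0 ltW.
rewrite sqnormD sqnormZ sqnorm_g (dotmxC f) dotmxZl (dotmxC (g y)).
have -> : t^-1 * (sqnorm f + (- t) ^+ 2 * 1 + 2 * (- t * dotmx f (g y))) =
   t^-1 * sqnorm f + t - 2 * dotmx f (g y).
  by field; rewrite gt_eqF.
lra.
Qed.

(** With [h = f - g], the difference [f f^t - g g^t] equals [h f^t + g h^t], and each product is
    bounded by submultiplicativity. *)
Lemma sqnorm_gram_diff_le x :
  sqnorm (part [set: J] x *m (part [set: J] x)^T - M) <=
  2 * (sqnorm (part [set: J] x) + 1) * defect x.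
Proof.
rewrite -(gM x) /defect -(sqnormN (g x - _)) opprB.
set f := part _ _; set h := f - g x.
have -> : f *m f^T - g x *m (g x)^T = h *m f^T + g x *m h^T.
  by rewrite /h linearB /= mulmxBl mulmxBr addrA subrK.
apply: le_trans (sqnormD_le _ _) _.
have := sqnorm_mul_le h f^T; have := sqnorm_mul_le (g x) h^T.
rewrite !sqnorm_tr sqnorm_g; lra.
Qed.

(* Under [x |-> rot I [ffun=> z] x] the matrix [f f^T - M] becomes
   [F rho z G^T + (F rho z G^T)^T] plus a term independent of [z]. *)
Lemma split_sqnorm_mul_le I x : (0 < d)%N ->
  sqnorm (part I x) * sqnorm (part (~: I) x) <=
  d%:R * (2 * split_sqnorm I x + 1) * avg_defect I x.
Proof.
move=> d0; set F := part I x; set G := part _ x.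
have d0' : 0 < d%:R :> R by rewrite ltr0n.
have := mean_sqnorm_sym_sandwich rho_design F G.
move=> /le_trans /(_ (mean_sqnorm_sym_sandwich_le rho_design F G
  (F *m F^T + G *m G^T - M))).
set m := mean _ => mge.
have : m <= mean (fun z =>
    2 * (2 * split_sqnorm I x + 1) * defect (rot I [ffun=> z] x)).
  apply: le_mean => z; set y := rot I _ x.
  have fE : part [set: J] y = F *m rho z + G.
    by rewrite (part_setC I) part_rot_in part_rot_out ?disjoint_setC.
  have -> : F *m rho z *m G^T + (F *m rho z *m G^T)^T +
      (F *m F^T + G *m G^T - M) = part [set: J] y *m (part [set: J] y)^T - M.
    rewrite fE linearD /= mulmxDl !mulmxDr !trmx_mul trmxK !mulmxA.
    have [_ h _ _] := rho_design.
    have -> : F *m rho z *m (rho z)^T = F by rewrite -mulmxA h mulmx1.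
    by rewrite addrA addrACA; congr (_ + _ - _); rewrite addrC.
  apply: le_trans (sqnorm_gram_diff_le y) _.
  apply: ler_wpM2r; first exact: sqnorm_ge0.
  have := sqnormD_le (F *m rho z) G; rewrite -fE sqnorm_mul_design //.
  rewrite /split_sqnorm -/F -/G; lra.
rewrite meanZ -/(avg_defect I x) => /(le_trans mge).
rewrite -(ler_pM2l d0') (_ : d%:R * (2 / _ * _) = 2 * (sqnorm F * sqnorm G)).
  lra.
by field; rewrite gt_eqF.
Qed.

(** Taking [t] slightly above and slightly below [1] in [avg_defect_ge] bounds [split_sqnorm] from
    both sides. *)
Lemma mean_abs_split_sqnorm I : tau <= 768^-1 ^+ 2 ->
  mean (fun x => `|split_sqnorm I x - 1|) <= 256^-1.
Proof.
move=> tau_small.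
(* Since [1536 = 2 * 768], the bound on [tau] makes this mean at most [3 / 768 = 256^-1]. *)
apply: (@le_trans _ _ (mean (fun x => 768^-1 + 1536 * avg_defect I x))).
  apply: le_mean => x; have D0 := avg_defect_ge0 I x.
  have /(_ ltac:(lra)) h1 := @avg_defect_ge (769 / 768) I x.
  have /(_ ltac:(lra)) h2 := @avg_defect_ge (767 / 768) I x.
  rewrite ler_norml; apply/andP.
  by split; move: h1 h2; rewrite !invfM !invrK; lra.
rewrite meanD meanZ mean_ffun_cst.
have := mean_avg_defect I; move: tau_small; rewrite exprVn expr2; lra.
Qed.

(** For fixed [x], left translation by [x] permutes the choices of [w], so the new coordinates in
    [I] are uniform. *)
Lemma mean_part_resample I x :
  mean (fun w => sqnorm (part I (rot I w x))) = weight I.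
Proof.
rewrite /weight -[RHS](@mean_inj _ _ (fun w => rot [set: J] w x)).
  apply: eq_mean => w; congr sqnorm; apply: eq_bigr => i iI.
  by rewrite !ffunE iI inE.
move=> w w' /ffunP ww; apply/ffunP => i; have := ww i.
by rewrite !ffunE inE => /mulgI.
Qed.

(* Resampling the coordinates in [I] changes [split_sqnorm I] only through
   [part I], and [split_sqnorm I] is nearly constant. *)
Lemma mean_abs_sub_weight I : tau <= 768^-1 ^+ 2 ->
  mean (fun x => `|sqnorm (part I x) - weight I|) <= 128^-1.
Proof.
move=> tau_small; have conc := mean_abs_split_sqnorm I tau_small.
apply: (@le_trans _ _ (mean (fun x => mean (fun w =>
    `|split_sqnorm I x - 1| + `|split_sqnorm I (rot I w x) - 1|)))).
  apply: le_mean => x.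
  rewrite -(mean_part_resample I x).
  rewrite -[X in `|X - _|]mean_ffun_cst -meanB.
  apply: le_trans (ler_norm_mean _) _; apply: le_mean => w.
  rewrite [X in _ + `|X - 1|]/split_sqnorm (part_rot_out w x (disjoint_setC I)).
  rewrite /split_sqnorm; set q := sqnorm (part (~: I) x).
  set a := sqnorm (part I x); set b := sqnorm (part I (rot I w x)).
  rewrite (_ : a - b = (a + q - 1) - (b + q - 1)); last by ring.
  exact: ler_normB.
(* For each fixed [w] the map [rot I w] is a bijection, so both terms have the same mean over
   [x]. *)
rewrite mean_swap.
apply: (@le_trans _ _ (mean (fun w : {ffun J -> T} => 256^-1 + 256^-1))).
  apply: le_mean => w; rewrite meanD lerD //.
  by rewrite (mean_inj (fun x => `|split_sqnorm I x - 1|) (@rot_inj I w)).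
rewrite mean_ffun_cst; lra.
Qed.

Lemma both_weights_large I : (0 < d)%N -> tau <= 768^-1 ^+ 2 ->
  16^-1 <= weight I -> 16^-1 <= weight (~: I) -> 1 <= 2304 * (d%:R * tau).
Proof.
move=> d0 tau_small WI WC.
have h1 := mean_abs_sub_weight I tau_small.
have h2 := mean_abs_sub_weight (~: I) tau_small.
(* The left integrand is positive only where both squared norms [p], [q] exceed [32^-1]. There
   [split_sqnorm_mul_le] makes [d%:R * avg_defect I x] at least [1152^-1], the value of
   [p q / (2 (p + q) + 1)] at [p = q = 32^-1]. The left mean is at least [1 / 2]. *)
have : mean (fun x => 1 - 32 * `|sqnorm (part I x) - weight I|
    - 32 * `|sqnorm (part (~: I) x) - weight (~: I)|) <=
    mean (fun x => 1152 * (d%:R * avg_defect I x)).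
  apply: le_mean => x; have := split_sqnorm_mul_le I x d0.
  have y0 : 0 <= d%:R * avg_defect I x by rewrite mulr_ge0 ?avg_defect_ge0.
  rewrite mulrAC; set y := d%:R * _ in y0 *; rewrite /split_sqnorm.
  set p := sqnorm _; set q := sqnorm _ => pq.
  have := normr_ge0 (p - weight I); have := normr_ge0 (q - weight (~: I)).
  have := ler_norm (weight I - p); have := ler_norm (weight (~: I) - q).
  rewrite !(distrC (weight _)).
  set u := `|p - _|; set v := `|q - _| => qv pu v0 u0.
  have [|uv] := leP (1 - 32 * u - 32 * v) 0; first lra.
  have p32 : 0 <= p - 32^-1 by lra.
  have q32 : 0 <= q - 32^-1 by lra.
  have := mulr_ge0 p32 q32; have := mulr_ge0 p32 y0; have := mulr_ge0 q32 y0.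
  have [|yl] := leP 1 (1152 * y); first lra.
  have y1 : 0 <= 1152^-1 - y by lra.
  have := mulr_ge0 p32 y1; have := mulr_ge0 q32 y1.
  nra.
rewrite !meanB !(meanZ 32) mean_ffun_cst (meanZ 1152) (meanZ _ (avg_defect I)).
have : d%:R * mean (avg_defect I) <= d%:R * tau.
  by rewrite ler_wpM2l ?mean_avg_defect.
lra.
Qed.

(** For [I = [set i]] the factor [sqnorm (part I x)] is the constant [sqnorm (A i)], so the product
    bound controls the remaining part at every [x]. *)
Lemma dominant_coordinate i : (0 < d)%N -> 3 / 4 <= sqnorm (A i) ->
  mean (fun x => sqnorm (g x - A i *m rho (x i))) <= 36 * (d%:R * tau).
Proof.
move=> d0 Ai; have d1 : 1 <= d%:R :> R by rewrite ler1n.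
apply: (@le_trans _ _ (mean (fun x =>
    2 * defect x + 34 * (d%:R * avg_defect [set i] x)))).
  apply: le_mean => x.
  have -> : g x - A i *m rho (x i) =
      (g x - part [set: J] x) + part (~: [set i]) x.
    by rewrite (part_setC [set i]) {1}/part finset.big_set1 opprD addrA subrK.
  apply: le_trans (sqnormD_le _ _) _; rewrite lerD2l.
  have := split_sqnorm_mul_le [set i] x d0.
  have /(_ ltac:(lra)) := @avg_defect_ge (4 / 3) [set i] x.
  have D0 := avg_defect_ge0 [set i] x.
  have y0 : avg_defect [set i] x <= d%:R * avg_defect [set i] x.
    by rewrite ler_peMl.
  rewrite mulrAC; set y := d%:R * _ in y0 *; rewrite /split_sqnorm sqnorm_part1.
  have := sqnorm_ge0 (part (~: [set i]) x).
  set p := sqnorm (A i) in Ai *; set q := sqnorm _ => q0 h1 h2.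
  (* If [p + q] is large, [t = 4 / 3] in [avg_defect_ge] alone bounds [q] by 17 times the averaged
     defect. Otherwise the product bound and [3 / 4 <= p] give [q <= 6 * y]. *)
  have [s1|s1] := leP (7 / 4) (p + q).
    by move: h1; rewrite invfM invrK; lra.
  nra.
have tau0 : 0 <= tau.
  apply: le_trans defect_le.
  rewrite -(mean_ffun_cst 0); apply: le_mean => x; exact: sqnorm_ge0.
rewrite meanD (meanZ 2 defect) (meanZ 34) (meanZ _ (avg_defect [set i])).
have : d%:R * mean (avg_defect [set i]) <= d%:R * tau.
  by rewrite ler_wpM2l ?mean_avg_defect.
have : tau <= d%:R * tau by rewrite ler_peMl.
have := defect_le; lra.
Qed.

(** Take a minimal [I] of weight at least [16^-1] and [i] in it. Both [I :\ i] and [~: I] weigh less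
    than [16^-1], while the total is at least [255 / 256], so [i] carries the rest. *)
Lemma exists_dominant_coordinate : tau <= 768^-1 ^+ 2 ->
  (forall I, 16^-1 <= weight I -> weight (~: I) < 16^-1) ->
  exists i, 3 / 4 <= sqnorm (A i).
Proof.
move=> tau_small unbalanced.
have total I : 255 / 256 <= weight I + weight (~: I).
  have := mean_abs_split_sqnorm I tau_small.
  have : mean (fun x => 1 - `|split_sqnorm I x - 1|) <= mean (split_sqnorm I).
    apply: le_mean => x; have := ler_norm (1 - split_sqnorm I x).
    rewrite distrC; lra.
  rewrite meanB mean_ffun_cst.
  rewrite (meanD _ _ : mean (split_sqnorm I) = weight I + weight (~: I)); lra.
have [I /minsetP [WI minI]] : {I | minset (fun I => 16^-1 <= weight I) I}.
  apply: ex_minset; exists [set: J].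
  have := total [set: J]; rewrite finset.setCT weight0; lra.
have [I0|[i iI]] := set_0Vmem I; first by move: WI; rewrite I0 weight0; lra.
exists i.
have Wi : weight (I :\ i) < 16^-1.
  rewrite ltNge; apply/negP => /minI /(_ (subD1set _ _)) /setP /(_ i).
  by rewrite !inE eqxx iI.
have : weight I = sqnorm (A i) + weight (I :\ i).
  rewrite -weight1 -weight_setU ?finset.setD1K //.
  by rewrite disjoints1 !inE eqxx.
have := total I; have := unbalanced I WI; lra.
Qed.

Lemma near_linear_near_dictator (j0 : J) : (0 < d)%N ->
  exists i B,
    mean (fun x => sqnorm (g x - B *m rho (x i))) <= 10 ^+ 6 * (d%:R * tau).
Proof.
move=> d0; have d1 : 1 <= d%:R :> R by rewrite ler1n.
have tau0 : 0 <= tau.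
  apply: le_trans defect_le.
  rewrite -(mean_ffun_cst 0); apply: le_mean => x; exact: sqnorm_ge0.
have dtau : tau <= d%:R * tau by rewrite ler_peMl.
(* If the claimed bound is at least [1], the zero matrix works at any coordinate because
   [sqnorm (g x) = 1]. *)
have [big|small] := leP 1 (10 ^+ 6 * (d%:R * tau)).
  exists j0, 0; apply: le_trans big.
  under eq_mean => x do rewrite mul0mx subr0 sqnorm_g.
  by rewrite mean_ffun_cst.
(* The constant [10 ^+ 6] exceeds [768 ^+ 2] here, and [2304] in the contradiction with
   [both_weights_large]. *)
have tau_small : tau <= 768^-1 ^+ 2 by lra.
have [I WI|i Ai] := exists_dominant_coordinate tau_small.
  rewrite ltNge; apply/negP => WC.
  have := both_weights_large d0 tau_small WI WC; lra.
exists i, (A i); apply: le_trans (dominant_coordinate d0 Ai) _; lra.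
Qed.

End NearLinear.

(** * The standard representation of the symmetric group *)

Section StandardRepresentation.
Variable R : realType.

(** Composing with [tperm a c] shows that all points give the same mean; averaging over the points
    then allows reindexing by [z]. *)
Lemma mean_perm_apply (X : finType) (v : X -> R) (a : X) :
  mean (fun z : {perm X} => v (z a)) = mean v.
Proof.
have ind c : mean (fun z : {perm X} => v (z c)) =
    mean (fun z : {perm X} => v (z a)).
  rewrite -[RHS](mean_inj _ (mulgI (tperm a c))); apply: eq_mean => z.
  by rewrite permM tpermL.
rewrite -[LHS](mean_cst a) -[RHS](mean_cst (1%g : {perm X})).
under eq_mean => c do rewrite -(ind c).
by rewrite mean_swap; apply: eq_mean => z; apply/mean_inj/perm_inj.
Qed.

(* For fixed [a] the correlation takes one common value at all [c != a], and
   summing over [c] gives [0]. *)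
Lemma mean_perm_apply2 (X : finType) (v t : X -> R) (a c : X) :
  (1 < #|X|)%N -> \sum_x t x = 0 ->
  mean (fun z : {perm X} => v (z a) * t (z c)) =
  (\sum_x v x * t x) / (#|X|%:R - 1) * ((a == c)%:R - #|X|%:R^-1).
Proof.
move=> X1 t0; pose k c := mean (fun z : {perm X} => v (z a) * t (z c)).
rewrite -/(k c).
have Xn0 : #|X|%:R != 0 :> R by rewrite pnatr_eq0 -lt0n ltnW.
have X1n0 : #|X|%:R - 1 != 0 :> R by rewrite subr_eq0 pnatr_eq1 gtn_eqF.
have ka : k a = (\sum_x v x * t x) / #|X|%:R.
  by rewrite /k (mean_perm_apply (fun x => v x * t x)) mulrC.
have [<-|ac] := eqVneq a c; first by rewrite ka mulr1n; field; rewrite X1n0 Xn0.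
have kc c' : a != c' -> k c' = k c.
  move=> ac'; rewrite /k -(mean_inj _ (mulgI (tperm c c'))).
  by apply: eq_mean => z; rewrite !permM tpermR tpermD // eq_sym.
have : \sum_c' k c' = 0.
  rewrite -mean_sum; under eq_mean => z.
    have -> : \sum_c' v (z a) * t (z c') = v (z a) * \sum_x t x.
      by rewrite -mulr_sumr [in RHS](reindex_inj (@perm_inj _ z)).
    rewrite t0 mulr0; over.
  by rewrite (mean_cst (1%g : {perm X})).
rewrite (bigD1 a) //= ka (eq_bigr (fun=> k c)); last first.
  by move=> c'; rewrite eq_sym; apply: kc.
rewrite sumr_const cardC1 -[k c *+ _]mulr_natl.
rewrite -subn1 natrB ?(ltnW X1) // => h.
apply: (mulfI X1n0); rewrite -[LHS](addKr ((\sum_x v x * t x) / #|X|%:R)) h.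
by field; rewrite Xn0.
Qed.

(** In the kernel [(a == c)%:R - #|X|%:R^-1] of [mean_perm_apply2], the constant is annihilated by
    [\sum_x u x = 0]. *)
Lemma mean_perm_bilinear (X : finType) (u v w t : X -> R) :
  (1 < #|X|)%N -> \sum_x u x = 0 -> \sum_x t x = 0 ->
  mean (fun z : {perm X} =>
    (\sum_a u a * v (z a)) * (\sum_c w c * t (z c))) =
  (\sum_x u x * w x) * (\sum_x v x * t x) / (#|X|%:R - 1).
Proof.
move=> X1 u0 t0.
under eq_mean => z.
  rewrite mulrC mulr_suml.
  under eq_bigr => c _.
    rewrite mulr_sumr.
    under eq_bigr => a _ do rewrite mulrACA [w c * _]mulrC [t _ * _]mulrC.
    over.
  over.
rewrite mean_sum !mulr_suml; set K := (\sum_x v x * t x) / (#|X|%:R - 1).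
apply: eq_bigr => c _; rewrite mean_sum.
under eq_bigr => a _.
  rewrite meanZ mean_perm_apply2 // -/K.
  rewrite (_ : _ * _ = u a * (a == c)%:R * (w c * K)
     + u a * (- (w c * K / #|X|%:R))); last by ring.
  over.
rewrite big_split /= -!mulr_suml u0 mul0r addr0 (bigD1 c) //= eqxx mulr1.
rewrite big1 ?addr0 ?mulrA // => a /negPf ->.
by rewrite mulr0.
Qed.

Variables (k : nat) (i0 : 'I_k.+2) (U : 'M[R]_k.+2).
Hypothesis U_basis : is_std_basis i0 U.

(** The columns of [W] form an orthonormal basis of the vectors with coordinate sum zero. *)
Let W : 'M[R]_(k.+2, k.+1) := col' i0 U.

Lemma std_basis_sum0 j : \sum_a W a j = 0.
Proof.
have [UU U0] := U_basis.
have c0 : (Num.sqrt k.+2%:R : R)^-1 != 0.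
  by rewrite invr_eq0 sqrtr_eq0 -ltNge ltr0n.
apply: (mulfI c0); rewrite mulr0 mulr_sumr.
have /matrixP /(_ i0 (lift i0 j)) := UU; rewrite !mxE (negPf (neq_lift _ _)).
move=> orth; apply: etrans orth; apply: eq_bigr => a _.
rewrite !mxE; congr (_ * _).
by have /matrixP /(_ a 0) := U0; rewrite !mxE.
Qed.

Lemma std_basis_orthonormal j l : \sum_a W a j * W a l = (j == l)%:R.
Proof.
have [UU _] := U_basis.
have /matrixP /(_ (lift i0 j) (lift i0 l)) := UU.
rewrite !mxE (inj_eq lift_inj) => <-; apply: eq_bigr => a _.
by rewrite !mxE.
Qed.

(** The rows of [U] are orthonormal as well, and its constant column contributes [k.+2%:R^-1] to
    their products. *)
Lemma std_basis_complete a b :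
  \sum_j W a j * W b j = (a == b)%:R - k.+2%:R^-1.
Proof.
have [/mulmx1C UU U0] := U_basis.
have Ui c : U c i0 = (Num.sqrt k.+2%:R)^-1.
  by have /matrixP /(_ c 0) := U0; rewrite !mxE.
have /matrixP /(_ a b) := UU; rewrite !mxE (bigD1_ord i0) //= !mxE !Ui.
rewrite -invfM -expr2 sqr_sqrtr ?ler0n // => <-.
rewrite [RHS]addrC addKr; apply: eq_bigr => j _.
by rewrite !mxE.
Qed.

Lemma rho1E z i j : rho1 i0 U z i j = \sum_a W a i * W (z a) j.
Proof.
rewrite /rho1 !mxE; under eq_bigr => b _ do rewrite !mxE mulr_suml.
rewrite exchange_big; apply: eq_bigr => a _.
rewrite (bigD1 (z a)) //= big1 ?addr0.
  by rewrite !mxE eqxx mulr1.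
by move=> b /negPf bz; rewrite !mxE eq_sym bz mulr0 mul0r.
Qed.

(** Between the two factors stands [W *m W^T], the identity minus a constant matrix; the constant
    vanishes because the columns of [W] sum to zero. *)
Lemma rho1M : {morph rho1 i0 U : x y / (x * y)%g >-> x *m y}.
Proof.
move=> x y; apply/matrixP => i l; rewrite rho1E mxE.
under [RHS]eq_bigr => j _ do rewrite !rho1E mulr_suml.
rewrite exchange_big; apply: eq_bigr => a _.
under eq_bigr => j _ do rewrite -mulrA mulr_sumr.
rewrite -mulr_sumr exchange_big permM; congr (_ * _).
under eq_bigr => b _.
  under eq_bigr => j _ do rewrite mulrA.
  rewrite -mulr_suml std_basis_complete mulrBl; over.
have yW : \sum_b W (y b) l = 0.
  by rewrite -[RHS](std_basis_sum0 l) [RHS](reindex_inj (@perm_inj _ y)).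
rewrite sumrB -mulr_sumr yW mulr0 subr0 (bigD1 (x a)) //= eqxx mul1r.
by rewrite big1 ?addr0 // => b /negPf bx; rewrite eq_sym bx mul0r.
Qed.

Lemma rho1_orthogonal z : rho1 i0 U z *m (rho1 i0 U z)^T = 1%:M.
Proof.
have -> : (rho1 i0 U z)^T = rho1 i0 U z^-1%g.
  apply/matrixP => i j; rewrite mxE !rho1E (reindex_inj (@perm_inj _ z^-1%g)).
  by apply: eq_bigr => a _; rewrite permKV mulrC.
rewrite -rho1M mulgV; apply/matrixP => i j; rewrite rho1E mxE.
under eq_bigr => a _ do rewrite perm1.
exact: std_basis_orthonormal.
Qed.

Lemma rho1_design : is_orthogonal_design (rho1 i0 U).
Proof.
split; [exact: rho1M | exact: rho1_orthogonal | |].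
- move=> i j; under eq_mean => z do rewrite rho1E.
  rewrite mean_sum big1 // => a _.
  by rewrite meanZ (mean_perm_apply (W^~ j)) /mean std_basis_sum0 !mulr0.
- move=> i j l e; under eq_mean => z do rewrite !rho1E.
  have X1 : (1 < #|'I_k.+2|)%N by rewrite card_ord.
  have := mean_perm_bilinear (W^~ j) (W^~ l) X1
    (std_basis_sum0 i) (std_basis_sum0 e).
  rewrite !std_basis_orthonormal -natrM mulnb card_ord => ->.
  by congr (_ / _); rewrite mulrS addrAC subrr add0r.
Qed.

End StandardRepresentation.

(** * Passage to the Frobenius distance of the statement *)

Lemma mean_sq_distE (R : realType) (T : finType) (p q : nat)
    (f h : T -> 'M[R]_(p, q)) :
  mean_sq_dist f h = mean (fun x => sqnorm (f x - h x)).
Proof.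
apply: eq_mean => x; rewrite /frobenius_norm sqnormE sqr_sqrtr //.
by do 2 ![apply: sumr_ge0 => ? _]; exact: sqr_ge0.
Qed.

Local Open Scope classical_set_scope.


Theorem theorem8p1 (R : realType) :
  exists2 C : R, 0 < C &
  forall (m n : nat) (m_ge2 : (2 <= m)%N) (n_ge1 : (1 <= n)%N)
    (i0 : 'I_m) (i0_first : i0 = 0%N :> nat)
    (U : 'M[R]_m) (U_basis : is_std_basis i0 U)
    (g : {ffun 'I_n -> 'S_m} -> 'M[R]_m.-1) (tau : R),
  expect g = 0 ->
  (exists2 M : 'M[R]_m.-1, \tr M = 1 & forall x, g x *m (g x)^T = M) ->
  (exists2 mu : R,
     is_min [set mean_sq_dist g l | l in Lin i0 U] mu & mu <= tau) ->
  exists (i : 'I_n) (A : 'M[R]_m.-1),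
    mean_sq_dist g (fun x => A *m rho1 i0 U (x i)) <= C * m%:R ^+ 5 * tau.
Proof.
exists (10 ^+ 6); first by rewrite exprn_gt0 // ltr0n.
case=> [|[|k]] // n _ n_ge1 i0 _ U U_basis g tau _ [M trM gM].
case=> mu [[l lLin lmu] _] mu_tau; case: lLin => A lE.
have near : mean (defect (rho1 i0 U) A g) <= tau.
  rewrite (le_trans _ mu_tau) // -lmu mean_sq_distE.
  apply: le_mean => x; rewrite /defect lE /part.
  by under eq_bigl => i do rewrite inE.
have tau0 : 0 <= tau.
  apply: le_trans near; rewrite mulr_ge0 ?invr_ge0 ?ler0n //.
  by apply: sumr_ge0 => x _; exact: sqnorm_ge0.
have [i [B hB]] := near_linear_near_dictator (rho1_design U_basis) trM gM near
  (Ordinal n_ge1) (ltn0Sn k).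
exists i, B; rewrite mean_sq_distE; apply: le_trans hB _.
(* With [m = k.+2] the bound obtained has the factor [m - 1], which is at most [m ^ 5]. *)
rewrite -mulrA ler_wpM2l ?exprn_ge0 ?ler0n // ler_wpM2r //.
by rewrite -natrX ler_nat (leq_trans (leqnSn _)) // -[leqLHS]expn1 leq_exp2l.
Qed.
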